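(* Fix an integer $Q \ge 1$ (qubits per node) and a tolerance $\varepsilon \in (0,1)$. For an integer $P \ge 1$, consider the inverse quantum Fourier transform on $n = PQ$ qubits distributed over $P$ nodes of $Q$ qubits each. In the communication-efficient distributed inverse quantum Fourier transform (the one in which communication blocks are pruned with threshold $t = \lceil -\log_2 \varepsilon \rceil$), the global entanglement complexity is $\mathcal{O}(P)$ as $P \to \infty$, i.e. it scales linearly in the number of nodes $P$, rather than with the quadratic $\mathcal{O}(P^2)$ scaling of the exact distributed implementation (in which all communication blocks are executed).
   Context: Nodes are indexed by $p \in \{0,1,\dots,P-1\}$, and each node hosts $Q$ qubits with local indices $q \in \{0,1,\dots,Q-1\}$. The global index of qubit $q$ of node $p$ is $I(q,p) = pQ + q$. In the inverse quantum Fourier transform, for every pair of qubits with global indices $I < J$, a controlled-phase gate with control $I$, target $J$ and angle $-\pi/2^{k}$ is applied, where $k = J - I$ is the index difference. For nodes $p < p'$, at distance $d = p'-p \ge 1$, the communication block between control node $p$ and target node $p'$ is the set of all $Q^2$ controlled-phase gates with control a qubit $q$ of node $p$ and target a qubit $q'$ of node $p'$; such a gate has index difference $k = Qd + (q'-q)$. Gates between qubits of the same node are local and require no communication. Exact distributed implementation: all communication blocks between pairs $p<p'$ are executed. Communication-efficient implementation: with $t = \lceil -\log_2 \varepsilon\rceil$, a communication block is discarded in its entirety if all its gates have $k > t$, and otherwise is executed in its entirety. Entanglement cost: each executed communication block consumes one EPR pair for each of the $Q$ control qubits of the control node (one EPR pair lets a control qubit act on arbitrarily many target qubits of one remote node),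 hence $Q$ EPR pairs per executed block. The global entanglement complexity is the total number of EPR pairs consumed over the whole network, i.e. $Q$ times the number of executed communication blocks, viewed as a function of $P$ with $Q$ and $\varepsilon$ fixed. *)

(* Defs.v *)
From HB Require Import structures.
From mathcomp Require Import all_boot all_order all_algebra.
From mathcomp Require Import all_classical all_reals all_analysis.
Set Implicit Arguments.
Unset Strict Implicit.
Unset Printing Implicit Defensive.
Import Order.TTheory GRing.Theory Num.Theory.
Local Open Scope ring_scope.

(* The qubit [(p, q)] is the one with local index [q] on node [p]. *)
Definition qubit (P Q : nat) := ('I_P * 'I_Q)%type.

Definition global_index (P Q : nat) (x : qubit P Q) : nat :=
  (x.1 * Q + x.2)%N.

(* A controlled-phase gate is represented by its pair (control, target); its
   angle [- pi / 2 ^ k] is determined by the index difference [k]. *)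
Definition gate (P Q : nat) := (qubit P Q * qubit P Q)%type.

Definition iqft_gates (P Q : nat) : {set gate P Q} :=
  [set g | (global_index g.1 < global_index g.2)%N].

(* The truncated subtraction is exact on [iqft_gates]. *)
Definition index_diff (P Q : nat) (g : gate P Q) : nat :=
  (global_index g.2 - global_index g.1)%N.

(* Communication blocks are identified with pairs (control node, target node);
   gates inside a single node are local and belong to no block. *)
Definition comm_blocks (P : nat) : {set 'I_P * 'I_P} :=
  [set b : 'I_P * 'I_P | (b.1 < b.2)%N].

Definition block_gates (P Q : nat) (b : 'I_P * 'I_P) : {set gate P Q} :=
  [set g in iqft_gates P Q | (g.1.1 == b.1) && (g.2.1 == b.2)].

Definition threshold (R : realType) (eps : R) : int :=
  Num.ceil (- (ln eps / ln 2)).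

Definition discarded (P Q : nat) (t : int) (b : 'I_P * 'I_P) : bool :=
  [forall g in block_gates Q b, t < (index_diff g)%:Z].

Definition executed_exact (P : nat) : {set 'I_P * 'I_P} := comm_blocks P.

Definition executed_efficient (R : realType) (eps : R) (P Q : nat) :
    {set 'I_P * 'I_P} :=
  [set b in comm_blocks P | ~~ discarded Q (threshold eps) b].

(* An executed block consumes one EPR pair for each of the [Q] qubits of its
   control node. *)
Definition epr_cost (P Q : nat) (executed : {set 'I_P * 'I_P}) : nat :=
  (Q * #|executed|)%N.

Definition exact_complexity (Q P : nat) : nat :=
  epr_cost Q (executed_exact P).

Definition efficient_complexity (R : realType) (eps : R) (Q P : nat) : nat :=
  epr_cost Q (executed_efficient eps P Q).

(* Main.v *)
(* The block at distance d contains only gates with index difference at least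
   Q(d - 1) + 1 >= d, so a pruned implementation executes only blocks at distance
   at most t, at most t per control node.  Conversely t >= 1, and the block
   between adjacent nodes contains the gate from the last qubit of one to the
   first qubit of the next, of index difference 1, so these P - 1 blocks are
   always executed.  Unpruned, there are P(P - 1)/2 blocks. *)
Require Import Defs.
From HB Require Import structures.
From mathcomp Require Import all_boot all_order all_algebra.
From mathcomp Require Import all_classical all_reals all_analysis.
From mathcomp Require Import zify.
Set Implicit Arguments.
Unset Strict Implicit.
Unset Printing Implicit Defensive.
Import Order.TTheory GRing.Theory Num.Theory.
Import numFieldNormedType.Exports.
Local Open Scope classical_set_scope.
Local Open Scope ring_scope.

(** Reduces each asymptotic claim to an inequality in [nat]. The range [1 < n] leaves out a single
    node, which has no blocks and would break the lower bounds. *)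
Lemma eqO_natr (R : realType) (a b : nat -> nat) (C : nat) :
  (forall n, 1 < n -> a n <= C * b n)%N ->
  (fun n => (a n)%:R : R) =O_\oo (fun n => (b n)%:R : R).
Proof.
(* The witness must be positive, and [C] may be 0. *)
move=> leab; apply/eqO_exP; exists C.+1%:R; first by rewrite ltr0n.
near=> n; rewrite !ger0_norm ?ler0n// -natrM ler_nat.
have n_gt1 : (1 < n)%N by near: n; exact: nbhs_infty_gt.
by rewrite (leq_trans (leab n n_gt1))// leq_mul2r leqnSn orbT.
Unshelve. all: by end_near.
Qed.

Lemma threshold_gt0 (R : realType) (eps : R) :
  0 < eps -> eps < 1 -> 0 < threshold eps.
Proof.
move=> eps0 eps1; rewrite /threshold ceil_gt0 oppr_gt0.
by rewrite pmulr_llt0 ?invr_gt0 ?ln_gt0 ?ltr1n// ln_lt0// eps0 eps1.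
Qed.

Lemma index_diff_ge_distance (P Q : nat) (g : gate P Q) :
  (g.1.1 < g.2.1)%N -> (g.2.1 - g.1.1 <= index_diff g)%N.
Proof.
case: g => -[p q] [p' q'] /= ltp; rewrite /index_diff /global_index /=.
(* [q < Q] also yields [0 < Q], which gives [Q * (d - 1) + 1 >= d]. *)
have := ltn_ord q; nia.
Qed.

Lemma card_executed_efficient_le (R : realType) (eps : R) (P Q : nat) :
  (#|executed_efficient eps P Q| <= P * `|threshold eps|.+1)%N.
Proof.
rewrite /executed_efficient; set t := threshold eps.
(* A block is coded by control node and distance. On executed blocks the distance is at most [|t|],
   so [inord] does not fall back to its default and [f] is injective there. *)
pose f (b : 'I_P * 'I_P) : 'I_P * 'I_`|t|.+1 := (b.1, inord (b.2 - b.1)).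
have dist_le b : b \in executed_efficient eps P Q ->
    (b.1 < b.2)%N /\ (b.2 - b.1 <= `|t|)%N.
  rewrite !inE => /andP[ltb /forallPn[g]].
  rewrite negb_imply !inE => /andP[/andP[_ /andP[/eqP e1 /eqP e2]]] tg.
  split=> //; rewrite -e1 -e2.
  apply: leq_trans (index_diff_ge_distance _) _; first by rewrite e1 e2.
  by move: tg; rewrite -/t; lia.
rewrite -[P in (P * _)%N]card_ord -[_.+1 in leqRHS]card_ord -card_prod.
rewrite -(@card_in_imset _ _ f) ?max_card// => -[i j] [i' j'].
move=> /dist_le[/= lt1 le1] /dist_le[/= lt2 le2] [ei].
move=> /(congr1 val); rewrite /= !inordK ?ltnS// => ed.
by congr pair; apply: val_inj => //=; move: (congr1 val ei) => /=; lia.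
Qed.

Lemma card_executed_efficient_ge (R : realType) (eps : R) (P Q : nat) :
  (0 < Q)%N -> 0 < eps -> eps < 1 ->
  (P.-1 <= #|executed_efficient eps P Q|)%N.
Proof.
case: Q P => // Q [//|P] _ eps0 eps1 /=; have t0 := threshold_gt0 eps0 eps1.
(* The adjacent pair of nodes [i] and [i + 1], among [P.+1] nodes. *)
pose f (i : 'I_P) := (widen_ord (leqnSn P) i, lift ord0 i).
have f_inj : injective f.
  by move=> i j [eij _]; apply: val_inj.
rewrite -[P in leqLHS]card_ord -(card_codom f_inj).
apply/subset_leq_card/fintype.subsetP => _ /codomP[i ->].
rewrite !inE /= leqnn /=; apply/forallPn.
exists (((f i).1, ord_max), ((f i).2, ord0)).
rewrite negb_imply !inE /= !eqxx /index_diff /global_index /= -leNgt.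
by rewrite /bump /=; apply/andP; split; [apply/andP; split=> //|]; move: t0; nia.
Qed.

(** Target node [j] has [j] possible control nodes; sum over [j]. *)
Lemma card_comm_blocks (P : nat) : #|comm_blocks P| = 'C(P, 2).
Proof.
rewrite -bin2_sum big_mkord -sum1dep_card.
rewrite -(pair_big_dep xpredT (fun i j : 'I_P => i < j)%N (fun _ _ => 1%N)) /=.
rewrite (exchange_big_dep xpredT) //=; apply: eq_bigr => j _.
by rewrite -(big_ord_widen P (fun=> 1%N)) ?sum1_card ?card_ord// ltnW.
Qed.

Theorem corollary1 (R : realType) (Q : nat) (eps : R)
    (hQ : (1 <= Q)%N) (heps0 : 0 < eps) (heps1 : eps < 1) :
  let efficient := fun P : nat => (efficient_complexity eps Q P)%:R : R in
  let exact := fun P : nat => (exact_complexity Q P)%:R : R in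
  let linear := fun P : nat => P%:R : R in
  let quadratic := fun P : nat => P%:R ^+ 2 : R in
  [/\ efficient =O_\oo linear, linear =O_\oo efficient,
      exact =O_\oo quadratic & quadratic =O_\oo exact].
Proof.
move=> efficient exact linear quadratic.
have -> : quadratic = (fun P => (P ^ 2)%:R).
  by apply/funext => P; rewrite natrX.
rewrite /efficient /exact /linear /efficient_complexity /exact_complexity.
rewrite /epr_cost /executed_exact; split.
- apply: (@eqO_natr _ _ _ (Q * `|threshold eps|.+1)) => P _.
  by have := card_executed_efficient_le eps P Q; nia.
(* [P <= 2 * (P - 1)] once [P >= 2]. *)
- apply: (@eqO_natr _ _ _ 2) => P P_gt1.
  by have := card_executed_efficient_ge P hQ heps0 heps1; nia.
- apply: (@eqO_natr _ _ _ Q) => P _.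
  by rewrite card_comm_blocks; have := mul_bin_left P 1; rewrite bin1; nia.
(* One factor 2 clears the half in [P * (P - 1) / 2], the other absorbs [P <= 2 * (P - 1)]. *)
- apply: (@eqO_natr _ _ _ 4) => P P_gt1; rewrite card_comm_blocks.
  have := mul_bin_left P 1; rewrite bin1; nia.
Qed.
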